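(* Let $s\ge 4$ be an integer and $G\in\mathcal G^s_2$. Then $\lambda(G)\ge v(G)/(s+1)$.
   Context: All graphs are finite and simple. For integers $1\le r\le s$, $\mathcal G^s_r$ denotes the set of graphs in which every vertex has degree at least $r$ and at most $s$. $v(G)$ is the number of vertices of $G$. $\lambda(G)$ denotes the maximum number of pairwise vertex-disjoint subgraphs of $G$ each of which is a path with exactly two edges. *)

(* Defs.v *)
From mathcomp Require Import all_boot.
Set Implicit Arguments. Unset Strict Implicit. Unset Printing Implicit Defensive.

Definition simple_graph (V : finType) (e : rel V) : Prop :=
  symmetric e /\ irreflexive e.

Definition deg (V : finType) (e : rel V) (v : V) : nat := #|[set w | e v w]|.

Definition in_Grs (V : finType) (e : rel V) (r s : nat) : Prop :=
  forall v : V, r <= deg e v <= s.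

Definition is_P3 (V : finType) (e : rel V) (t : V * V * V) : bool :=
  let: (a, b, c) := t in [&& e a b, e b c & a != c].

Definition p3_verts (V : finType) (t : V * V * V) : {set V} :=
  let: (a, b, c) := t in [set a; b; c].

Definition p3_packing (V : finType) (e : rel V) (P : {set V * V * V}) : bool :=
  [forall t in P, is_P3 e t] &&
  [forall t in P, forall u in P, (t != u) ==> [disjoint p3_verts t & p3_verts u]].

Definition lambda (V : finType) (e : rel V) : nat :=
  \max_(P : {set V * V * V} | p3_packing e P) #|P|.

(* Main.v *)
(** Deleting edges, one may assume that every edge has an end of degree 2, so
    that the set [B] of vertices of degree at least 3 is independent.  Take a
    maximal packing [Q] of 3-vertex paths among the vertices of degree 2, and
    assign each vertex outside [B] and [Q] that has a neighbour in [B] to one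
    such neighbour.  Each [b] in [B] of load at least 2 is the centre of a
    3-vertex path, which is charged for [b] and its load, at most [s + 1]
    vertices.  The other vertices are those of a [b] of load at most 1 with its
    load (at most 2 vertices), and the vertices [H] outside [B] and [Q] without
    neighbour in [B].  For a suitable assignment such a [b] has at least two
    edges to [Q] or to vertices assigned to a centre of load exactly 2; a vertex
    of [H] has an edge to [Q].  As all the vertices so reached have degree 2, at
    most two such edges reach a given path of [Q], or the two vertices assigned
    to a given centre of load 2.  Hence each of these paths accounts for at
    most [3 + 2 <= s + 1] vertices. *)
Require Import Defs.
From mathcomp Require Import all_boot zify.

Set Implicit Arguments. Unset Strict Implicit. Unset Printing Implicit Defensive.

(** * Assignments of vertices to centres, and the loads of the centres *)

Definition load (V : finType) (R : {set V}) (f : V -> V) (b : V) : nat :=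
  #|[set x in R | f x == b]|.

(** A finite function, so that an assignment of largest total gain exists. *)
Definition reassign (V : finType) (f : {ffun V -> V}) (x b : V) : {ffun V -> V} :=
  [ffun z => if z == x then b else f z].

(* The values 0, 1, 3, 3, ... make it profitable to move a vertex from a load 1 to
   another load 1, and from a load at least 3 to a load at most 1. *)
Definition gain (k : nat) : nat := minn k.*2.-1 3.

Definition assignment (V : finType) (r : rel V) (R B : {set V}) (f : V -> V) : bool :=
  [forall x in R, (f x \in B) && r x (f x)].

Section Loads.
Variables (V : finType) (r : rel V) (R B : {set V}).
Implicit Types (f g : {ffun V -> V}) (x b c : V).

Definition total_gain f := \sum_(b in B) gain (load R f b).

Lemma load_reassign_to f x b : x \in R -> f x != b ->
  load R (reassign f x b) b = (load R f b).+1.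
Proof.
move=> xR fxb; rewrite /load.
have -> : [set z in R | reassign f x b z == b] = x |: [set z in R | f z == b].
  by apply/setP=> z; rewrite !inE ffunE; case: (z =P x) => [->|_]; rewrite ?xR ?eqxx.
by rewrite cardsU1 !inE xR (negbTE fxb).
Qed.

Lemma load_reassign_from f x b : x \in R -> f x != b ->
  load R f (f x) = (load R (reassign f x b) (f x)).+1.
Proof.
move=> xR fxb; rewrite /load.
have -> : [set z in R | f z == f x] = x |: [set z in R | reassign f x b z == f x].
  apply/setP=> z; rewrite !inE ffunE; case: (z =P x) => [->|//].
  by rewrite xR eqxx.
by rewrite cardsU1 !inE xR ffunE eqxx eq_sym (negbTE fxb).
Qed.

Lemma load_reassign_other f x b c : c != b -> c != f x ->
  load R (reassign f x b) c = load R f c.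
Proof.
move=> cb cfx; apply: eq_card => z; rewrite !inE ffunE.
case: (z =P x) => [->|//].
by rewrite eq_sym (negbTE cb) eq_sym (negbTE cfx).
Qed.

(** Only the loads of [b] and [f x] change. Their old gains stand on the left, which avoids
    subtraction. *)
Lemma total_gain_reassign f x b : x \in R -> f x != b -> b \in B -> f x \in B ->
  total_gain (reassign f x b) + gain (load R f b) + gain (load R f (f x))
  = total_gain f + gain (load R f b).+1 + gain (load R f (f x)).-1.
Proof.
move=> xR fxb bB fB; rewrite /total_gain.
have H (F : V -> nat) : \sum_(c in B) F c
    = F b + (F (f x) + \sum_(c in B | (c != b) && (c != f x)) F c).
  rewrite (bigD1 b) //= (bigD1 (f x)) /=; last by rewrite fB fxb.
  by congr (_ + (_ + _)); apply: eq_bigl => c; rewrite andbA.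
rewrite !H load_reassign_to // (load_reassign_from xR fxb) /=.
rewrite (eq_bigr (fun c => gain (load R f c))); first lia.
by move=> c /and3P[_ cb cf]; rewrite load_reassign_other.
Qed.

Lemma assignment_reassign f x b : assignment r R B f -> b \in B -> r x b ->
  assignment r R B (reassign f x b).
Proof.
move=> /forall_inP af bB rxb; apply/forall_inP => z zR; rewrite ffunE.
by case: eqP => [->|_]; [rewrite bB | apply: af].
Qed.

Definition optimal f :=
  assignment r R B f /\ forall g, assignment r R B g -> total_gain g <= total_gain f.

Lemma optimal_gain f x b : optimal f -> x \in R -> f x != b -> b \in B -> r x b ->
  gain (load R f b).+1 + gain (load R f (f x)).-1
  <= gain (load R f b) + gain (load R f (f x)).
Proof.
move=> [af mf] xR fxb bB rxb.
have /andP[fB _] := forall_inP af _ xR.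
have := total_gain_reassign xR fxb bB fB.
have := mf _ (assignment_reassign af bB rxb); lia.
Qed.

(** Moving [x] raises the gain at [b] from 1 to 3, and only a drop from load 2 to load 1 costs that
    much. *)
Lemma optimal_load1 f x b : optimal f -> x \in R -> f x != b -> b \in B -> r x b ->
  load R f b = 1 -> load R f (f x) = 2.
Proof.
move=> of_ xR fxb bB rxb lb.
have := optimal_gain of_ xR fxb bB rxb; have := load_reassign_from xR fxb.
rewrite lb /gain; lia.
Qed.

Lemma optimal_load0 f x b : optimal f -> x \in R -> f x != b -> b \in B -> r x b ->
  load R f b = 0 -> load R f (f x) = 1 \/ load R f (f x) = 2.
Proof.
move=> of_ xR fxb bB rxb lb.
have := optimal_gain of_ xR fxb bB rxb; have := load_reassign_from xR fxb.
rewrite lb /gain; lia.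
Qed.

Lemma load_lt2 f x y : x \in R -> y \in R -> x != y -> f x = f y ->
  1 < load R f (f x).
Proof.
move=> xR yR xy fxy; apply/card_gt1P; exists x, y.
by rewrite !inE xR yR fxy eqxx.
Qed.

(** If [b] has load 1, every such [x] is assigned to [b] itself. If [b] has load 0, two such
    vertices have distinct centres of load 1; moving one of them to [b] keeps the total gain, and
    then moving the other would increase it. *)
Lemma optimal_underloaded f b : optimal f -> b \in B -> load R f b <= 1 ->
  #|[set x in R | r x b & load R f (f x) != 2]| <= 1.
Proof.
move=> of_ bB lb; rewrite leqNgt; apply/negP => /card_gt1P[x [y []]].
rewrite !inE => /and3P[xR rx nx] /and3P[yR ry ny] xy.
have [l0|l1] : load R f b = 0 \/ load R f b = 1 by lia.
- have nb z : z \in R -> f z != b.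
    move=> zR; apply/negP => /eqP fzb; move: l0; apply/eqP.
    by rewrite -lt0n; apply/card_gt0P; exists z; rewrite !inE zR fzb eqxx.
  have [lx|lx] := optimal_load0 of_ xR (nb _ xR) bB rx l0; last by rewrite lx in nx.
  have [ly|ly] := optimal_load0 of_ yR (nb _ yR) bB ry l0; last by rewrite ly in ny.
  have fxy : f y != f x.
    apply/negP => /eqP fyx; have := load_lt2 xR yR xy (esym fyx); lia.
  have [af mf] := of_.
  have /andP[fB _] := forall_inP af _ xR.
  have og : optimal (reassign f x b).
    split; first exact: assignment_reassign.
    move=> g ag; have := mf _ ag.
    have := total_gain_reassign xR (nb _ xR) bB fB.
    by rewrite l0 lx /gain /=; lia.
  have gy : reassign f x b y = f y by rewrite ffunE eq_sym (negbTE xy).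
  have := @optimal_load1 _ y b og yR; rewrite gy nb // => /(_ isT bB ry).
  rewrite load_reassign_to ?nb // l0 load_reassign_other ?nb // => /(_ erefl).
  by rewrite ly.
- have [fxb|fxb] := eqVneq (f x) b; last first.
    by rewrite (optimal_load1 of_ xR fxb bB rx l1) in nx.
  have [fyb|fyb] := eqVneq (f y) b; last first.
    by rewrite (optimal_load1 of_ yR fyb bB ry l1) in ny.
  have := load_lt2 xR yR xy (etrans fxb (esym fyb)); rewrite fxb; lia.
Qed.

Lemma optimal_exists : (forall x, x \in R -> exists2 b, b \in B & r x b) ->
  exists f, optimal f.
Proof.
move=> H.
(* The default [x] is never taken on [R], where the hypothesis provides some [b]. *)
pose f0 : {ffun V -> V} := [ffun x => odflt x [pick b in B | r x b]].
have a0 : assignment r R B f0.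
  apply/forall_inP => x xR; rewrite ffunE; case: pickP => [b //|N].
  by have [b bB rb] := H x xR; have := N b; rewrite bB rb.
case: (@arg_maxnP _ f0 (fun f : {ffun V -> V} => assignment r R B f) total_gain a0) => f af mf.
by exists f.
Qed.

End Loads.

(** * Packings of 3-vertex paths *)

Definition covered (V : finType) (P : {set V * V * V}) : {set V} :=
  \bigcup_(t in P) p3_verts t.

Lemma p3_packingP (V : finType) (e : rel V) (P : {set V * V * V}) :
  reflect ({in P, forall t, is_P3 e t} /\
           {in P &, forall t u, t != u -> [disjoint p3_verts t & p3_verts u]})
          (p3_packing e P).
Proof.
apply: (iffP andP) => -[H1 H2]; split.
- by move=> t tP; apply: (forall_inP H1).
- by move=> t u tP uP tu; have /forall_inP/(_ u uP)/implyP := forall_inP H2 t tP; apply.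
- by apply/forall_inP.
- apply/forall_inP=> t tP; apply/forall_inP => u uP; apply/implyP; exact: H2.
Qed.

Lemma p3_verts_covered (V : finType) (P : {set V * V * V}) t :
  t \in P -> p3_verts t \subset covered P.
Proof. exact: bigcup_sup. Qed.

Lemma p3_packingU (V : finType) (e : rel V) (P1 P2 : {set V * V * V}) :
  p3_packing e P1 -> p3_packing e P2 -> [disjoint covered P1 & covered P2] ->
  p3_packing e (P1 :|: P2) /\ #|P1 :|: P2| = #|P1| + #|P2|.
Proof.
move=> /p3_packingP[p1 d1] /p3_packingP[p2 d2] d.
have D12 t u : t \in P1 -> u \in P2 -> [disjoint p3_verts t & p3_verts u].
  move=> /p3_verts_covered s1 /p3_verts_covered s2.
  exact: disjointWl s1 (disjointWr s2 d).
split.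
  apply/p3_packingP; split=> [t /setUP[]|t u /setUP[] tP /setUP[] uP tu]; auto.
  by rewrite disjoint_sym; auto.
rewrite cardsU; suff -> : P1 :&: P2 = set0 by rewrite cards0 subn0.
apply/eqP; rewrite -subset0; apply/subsetP => t /setIP[t1 t2].
(* A path in both packings would be disjoint from itself, yet it contains its first vertex. *)
have := D12 t t t1 t2; case: t {t1 t2} => [[a b] c] /pred0P/(_ a).
by rewrite /= !inE eqxx.
Qed.

Lemma p3_packing1 (V : finType) (e : rel V) t : is_P3 e t -> p3_packing e [set t].
Proof.
move=> et; apply/p3_packingP; split=> [u /set1P->//|u w /set1P-> /set1P->].
by rewrite eqxx.
Qed.

Lemma covered1 (V : finType) (t : V * V * V) : covered [set t] = p3_verts t.
Proof. exact: big_set1. Qed.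

Lemma leq_lambda (V : finType) (e : rel V) (P : {set V * V * V}) :
  p3_packing e P -> #|P| <= lambda e.
Proof. by move=> eP; rewrite /lambda (bigD1 P) //= leq_maxl. Qed.

Lemma lambda_mono (V : finType) (e e' : rel V) :
  subrel e' e -> lambda e' <= lambda e.
Proof.
move=> sub; apply/bigmax_leqP => P /p3_packingP[p d]; apply: leq_lambda.
apply/p3_packingP; split=> // t /p; case: t => [[a b] c] /= /and3P[ab bc ac].
by rewrite ac !sub.
Qed.

(** Each [b] of load at least 2 is the middle of a path whose ends are two vertices assigned to
    it. *)
Lemma star_packing (V : finType) (e : rel V) (R B : {set V}) (f : V -> V) :
  symmetric e -> {in R, forall x, [&& x \notin B, f x \in B & e x (f x)]} ->
  exists P, [/\ p3_packing e P, covered P \subset R :|: B &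
             #|P| = #|[set b in B | 1 < load R f b]| ].
Proof.
move=> esym Hf; set G := [set b in B | _].
have /fin_all_exists[tr Htr] : forall b : V, exists t : V * V * V, b \in G ->
    [/\ t.1.2 = b, t.1.1 \in R, t.2 \in R, t.1.1 != t.2 & (f t.1.1 = b) * (f t.2 = b)].
  (* The triple [(b, b, b)] is a dummy value outside [G]. *)
  move=> b; case bG : (b \in G); last by exists (b, b, b).
  move: bG; rewrite inE => /andP[_ /card_gt1P[x [y []]]].
  rewrite !inE => /andP[xR /eqP fx] /andP[yR /eqP fy] xy.
  by exists (x, b, y); rewrite fx fy.
have GB b : b \in G -> b \in B by rewrite inE => /andP[].
(* [h] recovers the centre from any vertex of its path, which makes the paths disjoint. *)
pose h v := if v \in B then v else f v.
have Hh b v : b \in G -> v \in p3_verts (tr b) -> h v = b /\ v \in R :|: B.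
  move=> bG; have := Htr b bG; case: (tr b) => [[x b'] y] /= [-> xR yR _ [fx fy]].
  have /and3P[xB _ _] := Hf x xR; have /and3P[yB _ _] := Hf y yR.
  rewrite !inE /h => /orP[/orP[]|] /eqP ->.
  - by rewrite (negbTE xB) xR.
  - by rewrite GB // orbT.
  - by rewrite (negbTE yB) yR.
exists [set tr b | b in G]; split.
- apply/p3_packingP; split=> [t /imsetP[b bG ->]|t u /imsetP[b bG ->] /imsetP[c cG ->] ne].
    have := Htr b bG; case: (tr b) => [[x b'] y] /= [-> xR yR xy [fx fy]].
    have /and3P[_ _] := Hf x xR; have /and3P[_ _] := Hf y yR.
    by rewrite fx fy xy esym => -> ->.
  apply/pred0P => v; apply/negP => /andP[/= vb vc]; case/negP: ne.
  by rewrite -(Hh b v bG vb).1 -(Hh c v cG vc).1.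
- apply/bigcupsP => t /imsetP[b bG ->]; apply/subsetP => v vb.
  exact: (Hh b v bG vb).2.
- apply: card_in_imset => b c bG cG E.
  by have [<- _ _ _ _] := Htr b bG; rewrite E; have [-> _ _ _ _] := Htr c cG.
Qed.

(** * Counting tools and maximal packings *)

Lemma sum_load (V : finType) (R B : {set V}) (f : V -> V) :
  {in R, forall x, f x \in B} -> #|R| = \sum_(b in B) load R f b.
Proof.
move=> fB; rewrite -sum1_card (partition_big f (mem B)) //=.
by apply: eq_bigr => b _; rewrite sum1dep_card.
Qed.

Lemma sum_adjacent (V : finType) (r : rel V) (W Z : {set V}) :
  \sum_(v in W) #|[set x in Z | r v x]| = \sum_(x in Z) #|[set v in W | r v x]|.
Proof.
under eq_bigr do rewrite -sum1dep_card big_mkcondr.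
rewrite exchange_big /=; apply: eq_bigr => x _.
by rewrite -big_mkcondr sum1dep_card.
Qed.

Lemma leq_sumU (V : finType) (A B : {set V}) (g : V -> nat) :
  \sum_(x in A :|: B) g x <= \sum_(x in A) g x + \sum_(x in B) g x.
Proof.
rewrite (big_setID A) /= (setIidPr (subsetUl A B)) leq_add2l setDUl setDv set0U.
rewrite [leqRHS](big_setID A) /=; exact: leq_addl.
Qed.

Lemma leq_sum_covered (V : finType) (P : {set V * V * V}) (g : V -> nat) :
  \sum_(x in covered P) g x <= \sum_(t in P) (g t.1.1 + g t.1.2 + g t.2).
Proof.
apply: (big_rec2 (fun (A : {set V}) n => \sum_(x in A) g x <= n)) => [|[[a b] c] A n _ IH].
  by rewrite big_set0.
apply: leq_trans (leq_sumU _ _ _) _; apply: leq_add => //.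
apply: leq_trans (leq_sumU _ _ _) _; rewrite big_set1 leq_add2r.
by apply: leq_trans (leq_sumU _ _ _) _; rewrite !big_set1.
Qed.

(** The neighbours of [x] in [W] and the set [A] are disjoint parts of the neighbourhood of [x]. *)
Lemma card_adjacent_in (V : finType) (e : rel V) (W A : {set V}) x :
  symmetric e -> {in A, forall v, e x v && (v \notin W)} ->
  #|[set v in W | e v x]| + #|A| <= deg e x.
Proof.
move=> esym HA.
have d : [set v in W | e v x] :&: A = set0.
  apply/eqP; rewrite -subset0; apply/subsetP => v; rewrite !inE => /andP[/andP[vW _] /HA].
  by rewrite vW andbF.
rewrite -[leqLHS]subn0 -(cards0 V) -d -cardsU; apply: subset_leq_card.
apply/subsetP => v; rewrite !inE => /orP[/andP[_]|/HA/andP[]//].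
by rewrite esym.
Qed.

(** A largest packing inside [S] works: a path in [S] that misses it could be added. *)
Lemma max_packing_in (V : finType) (e : rel V) (S : {set V}) :
  exists Q, [/\ p3_packing e Q, covered Q \subset S &
    forall t, is_P3 e t -> p3_verts t \subset S -> ~~ [disjoint p3_verts t & covered Q]].
Proof.
pose ok (Q : {set V * V * V}) := p3_packing e Q && (covered Q \subset S).
have ok0 : ok set0.
  by apply/andP; split; [apply/p3_packingP; split=> t; rewrite inE
                        | rewrite /covered big_set0 sub0set].
case: (@arg_maxnP _ set0 ok (fun Q => #|Q|) ok0) => Q /andP[pQ sQ] mQ; exists Q; split=> //.
move=> t et st; apply/negP; rewrite disjoint_sym -covered1 => d.
have [pU cU] := p3_packingU pQ (p3_packing1 et) d.
have : ok (Q :|: [set t]).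
  by rewrite /ok pU /covered bigcup_setU subUset sQ -/(covered [set t]) covered1.
by move/mQ; rewrite /geq /= cU cards1 addn1 ltnn.
Qed.

(** Each end of a path has an edge to the middle vertex, which leaves at most one edge to [W]; the
    middle vertex uses both its edges on the ends. *)
Lemma sum_adjacent_packing (V : finType) (e : rel V) (Q : {set V * V * V}) (W : {set V}) :
  symmetric e -> p3_packing e Q -> {in covered Q, forall x, deg e x <= 2} ->
  [disjoint W & covered Q] ->
  \sum_(x in covered Q) #|[set v in W | e v x]| <= 2 * #|Q|.
Proof.
move=> esym /p3_packingP[pQ _] dQ dW.
have nW x : x \in covered Q -> x \notin W.
  by move=> xQ; apply/negP => xW; have /pred0P/(_ x) := dW; rewrite /= xW xQ.
apply: leq_trans (leq_sum_covered _ _) _; rewrite mulnC -sum_nat_const.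
apply: leq_sum => -[[a b] c] tQ /=; have /= /and3P[ab bc ac] := pQ _ tQ.
have sub v : v \in [set a; b; c] -> v \in covered Q.
  by move=> vt; apply: subsetP (p3_verts_covered tQ) v vt.
have [aQ bQ cQ] : [/\ a \in covered Q, b \in covered Q & c \in covered Q].
  by split; apply: sub; rewrite !inE eqxx ?orbT.
have /(card_adjacent_in esym) : {in [set b], forall v, e a v && (v \notin W)}.
  by move=> v /set1P->; rewrite ab nW.
have /(card_adjacent_in esym) : {in [set b], forall v, e c v && (v \notin W)}.
  by move=> v /set1P->; rewrite esym bc nW.
have /(card_adjacent_in esym) : {in [set a; c], forall v, e b v && (v \notin W)}.
  by move=> v /set2P[]->; rewrite nW // ?bc // esym ab.
rewrite cards1 cards2 ac.
have := dQ a aQ; have := dQ b bQ; have := dQ c cQ; lia.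
Qed.

(** * Graphs in which every edge has an end of degree at most 2 *)

Lemma lambda_sparse (s : nat) (V : finType) (e : rel V) :
  4 <= s -> simple_graph e -> in_Grs e 2 s ->
  (forall u v, e u v -> deg e u <= 2 \/ deg e v <= 2) ->
  #|V| <= (s + 1) * lambda e.
Proof.
move=> s4 [esym eirr] eG sparse.
pose B := [set v | 2 < deg e v].
have [Q [pQ sQ mQ]] := max_packing_in e (~: B).
pose D := covered Q.
have DB x : x \in D -> x \notin B by move/(subsetP sQ); rewrite inE.
pose R := [set x | [&& x \notin B, x \notin D & [exists b in B, e x b]]].
pose H := [set x | [&& x \notin B, x \notin D & ~~ [exists b in B, e x b]]].
have [|f of_] := @optimal_exists V e R B.
  by move=> x; rewrite inE => /and3P[_ _ /exists_inP[b bB xb]]; exists b.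
have /forall_inP af := of_.1.
have HR : {in R, forall x, [&& x \notin B, f x \in B & e x (f x)]}.
  by move=> x xR; move: (xR); rewrite inE => /and3P[-> _ _]; exact: af.
have fB : {in R, forall x, f x \in B} by move=> x /HR/and3P[].
have small x : x \notin B -> deg e x <= 2 by rewrite inE -leqNgt.
pose Bad := [set b in B | load R f b <= 1].
pose Good := [set b in B | 1 < load R f b].
pose X2 := [set x in R | load R f (f x) == 2].
(* The star paths lie in [R :|: B], which misses [D], so they can be added to [Q]. *)
have lamQ : #|Q| + #|Good| <= lambda e.
  have [P [pP sP cP]] := star_packing esym HR.
  rewrite -cP; have [|pU <-] := p3_packingU pQ pP; last exact: leq_lambda.
  apply: disjointWr sP _; apply/pred0P => x; apply/negP => /andP[/= xD].
  by rewrite inE (negbTE (DB x xD)) orbF inE [x \in D]xD andbF.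
have cV : #|V| <= #|D| + #|H| + (#|R| + #|B|).
  rewrite -cardsT; have -> : [set: V] = (D :|: H) :|: (R :|: B).
    apply/setP => x; rewrite !in_setU !(inE, in_setT) -/B.
    case: (x \in D) => //=; case: (2 < deg e x) => //=.
    by case: [exists b in B, e x b].
  apply: leq_trans (leq_card_setU _ _).1 _; apply: leq_add; exact: (leq_card_setU _ _).1.
have cD : #|D| <= 3 * #|Q|.
  rewrite -sum1_card mulnC -sum_nat_const; exact: leq_sum_covered.
(* Compared at each [b]: a load at most 1 contributes at most 2; load 2 contributes at most 2 + 1 +
   2 = 5, within [s + 1] because [s] is at least 4; a larger load contributes at most [s + 1], with
   nothing from [X2]. *)
have cRB : #|R| + #|B| + #|X2| <= 2 * #|Bad| + (s + 1) * #|Good|.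
  have X2B : {in X2, forall x, f x \in B} by move=> x; rewrite inE => /andP[/fB].
  rewrite (sum_load fB) (sum_load X2B) -[#|B|]sum1_card -!big_split /=.
  have -> : #|Bad| = \sum_(b in B) (load R f b <= 1) by rewrite -sum1dep_card big_mkcondr.
  have -> : #|Good| = \sum_(b in B) (1 < load R f b) by rewrite -sum1dep_card big_mkcondr.
  rewrite !big_distrr -big_split /=; apply: leq_sum => b bB.
  have lX : load X2 f b <= (load R f b == 2) * 2.
    case: eqP => [l2|l2]; rewrite ?mul1n ?mul0n.
      rewrite -l2; apply: subset_leq_card; apply/subsetP => x.
      by rewrite !inE => /andP[/andP[-> _] ->].
    rewrite leqn0 cards_eq0 -subset0; apply/subsetP => x; rewrite !inE.
    by case/andP=> /andP[_ /eqP lx] /eqP fx; case: l2; rewrite -fx.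
  have ld : load R f b <= s.
    have /andP[_] := eG b; apply: leq_trans; apply: subset_leq_card.
    apply/subsetP => x; rewrite inE => /andP[/HR/and3P[_ _ xf] /eqP fx].
    by rewrite inE -fx esym.
  by case: (ltngtP (load R f b) 1) lX ld => ? /=; case: eqP => /=; lia.
have dW : [disjoint Bad :|: H & D].
  apply/pred0P => x; apply/negP => /andP[/= + xD].
  by rewrite !inE [x \in D]xD andbF orbF -/B => /andP[xB _]; have := DB x xD; rewrite inE xB.
(* [b] has at least 3 neighbours, all outside [B] by sparseness, hence in [D] or [R]; by optimality
   at most one of those in [R] is outside [X2]. *)
have BadP b : b \in Bad -> 2 <= #|[set x in D :|: X2 | e b x]|.
  move=> bBad; move: (bBad); rewrite inE => /andP[bB lb].
  have := optimal_underloaded of_ bB lb.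
  move: (bB); rewrite inE => db.
  have nb : [set w | e b w] \subset [set x in D :|: X2 | e b x]
              :|: [set x in R | e x b & load R f (f x) != 2].
    apply/subsetP => x; rewrite inE => bx.
    have xB : x \notin B.
      rewrite inE -leqNgt; have := sparse _ _ bx; lia.
    rewrite in_setU !in_set bx (esym x b) bx andbT.
    case xD : (x \in D) => //=; move: xB; rewrite inE => -> /=.
    have -> : [exists b0 in B, e x b0] by apply/exists_inP; exists b; rewrite // esym.
    by case: eqP.
  have := subset_leq_card nb; have := leq_card_setU [set x in D :|: X2 | e b x]
     [set x in R | e x b & load R f (f x) != 2].
  move=> [h _] h'; have := leq_trans h' h; rewrite -/(deg e b); lia.
(* Two neighbours of [x] form with it a path avoiding [B]. By maximality it meets [D], and not at
   [x]. *)
have HP x : x \in H -> 1 <= #|[set y in D :|: X2 | e x y]|.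
  rewrite inE => /and3P[xB xD /exists_inPn nB].
  have /andP[/card_gt1P[u [w [+ + uw]]] _] := eG x; rewrite !inE => xu xw.
  have uxw : is_P3 e (u, x, w) by rewrite /= esym xu xw uw.
  have nbB y : e x y -> y \notin B by move=> xy; apply/negP => /nB; rewrite xy.
  have /mQ : is_P3 e (u, x, w) by [].
  have -> : p3_verts (u, x, w) \subset ~: B.
    by rewrite /= !subUset !sub1set !in_setC xB !nbB.
  move=> /(_ isT) /pred0Pn[y /andP[/= yt yD]].
  apply/card_gt0P; exists y; rewrite inE in_setU [y \in D]yD /=.
  move: yt; rewrite !inE => /orP[/orP[]|] /eqP E; rewrite E //.
  by move: yD; rewrite E -/D (negbTE xD).
have dBH : [disjoint Bad & H].
  by apply/pred0P => x; apply/negP => /andP[/= ]; rewrite !inE => /andP[-> _].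
(* Double counting of the edges from [Bad] and [H] to [D] and [X2]. *)
have lower : 2 * #|Bad| + #|H| <= \sum_(v in Bad :|: H) #|[set x in D :|: X2 | e v x]|.
  rewrite (big_setID Bad) /= (setIidPr (subsetUl Bad H)) setDUl setDv set0U.
  have -> : H :\: Bad = H by apply/setDidPl; rewrite disjoint_sym.
  rewrite mulnC -sum_nat_const -sum1_card.
  by apply: leq_add; apply: leq_sum.
(* A vertex of [X2] has degree at most 2 and an edge to its centre of load 2, which is not in
   [Bad :|: H]; so at most one edge remains. *)
have upper : \sum_(v in Bad :|: H) #|[set x in D :|: X2 | e v x]| <= 2 * #|Q| + #|X2|.
  rewrite sum_adjacent; apply: leq_trans (leq_sumU _ _ _) _; apply: leq_add.
    by apply: sum_adjacent_packing => // x /DB/small.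
  rewrite -sum1_card; apply: leq_sum => x; rewrite inE => /andP[xR /eqP lx].
  have /and3P[xB fxB xf] := HR x xR.
  have /(card_adjacent_in esym) : {in [set f x], forall v, e x v && (v \notin Bad :|: H)}.
    move=> v /set1P->; rewrite xf in_setU negb_or !in_set lx andbF /=.
    by move: fxB; rewrite in_set => ->.
  have := small x xB; rewrite cards1; lia.
(* Adding up the bounds, [#|X2|] cancels and [#|V|] is at most [5 * #|Q| + (s + 1) * #|Good|]. *)
have : (s + 1) * (#|Q| + #|Good|) <= (s + 1) * lambda e by rewrite leq_mul2l lamQ orbT.
have : 5 * #|Q| <= (s + 1) * #|Q| by rewrite leq_mul2r; lia.
rewrite mulnDr; lia.
Qed.

(** * Reduction to the sparse case by deleting edges *)

Theorem theorem1p7 (s : nat) (V : finType) (e : rel V) :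
  4 <= s -> simple_graph e -> in_Grs e 2 s ->
  #|V| <= (s + 1) * lambda e.
Proof.
(* Induction on the number of ordered pairs of adjacent vertices. *)
move=> s4; have [n] := ubnP #|[set p | e p.1 p.2]|.
elim: n e => // n IH e le_n [esym eirr] eG.
have [/existsP[u /existsP[v /and3P[uv du dv]]]|] :=
  boolP [exists u, exists v, [&& e u v, 2 < deg e u & 2 < deg e v]]; last first.
  move=> N; apply: lambda_sparse => // u v uv.
  apply/orP; rewrite (leqNgt (deg e u)) (leqNgt (deg e v)) -negb_and; apply: contra N => N.
  by apply/existsP; exists u; apply/existsP; exists v; rewrite uv.
(* Comparing unordered pairs removes the edge in both directions, so that [e'] stays symmetric. *)
pose e' x y := e x y && ([set x; y] != [set u; v]).
have sub : subrel e' e by move=> x y /andP[].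
apply: leq_trans (IH e' _ _ _) _; last by rewrite leq_mul2l lambda_mono ?orbT.
- rewrite -ltnS; apply: leq_trans le_n; rewrite ltnS; apply: proper_card; apply/properP; split.
    by apply/subsetP => p; rewrite !inE => /sub.
  by exists (u, v); rewrite !inE //= /e' eqxx andbF.
- split=> [x y|x]; last by rewrite /e' eirr.
  by rewrite /e' esym setUC.
move=> x; have /andP[d2 ds] := eG x; apply/andP; split; last first.
  by apply: leq_trans ds; apply: subset_leq_card; apply/subsetP => y; rewrite !inE => /sub.
(* Only [z] can leave the neighbourhood of [y], so a degree of at least 3 stays at least 2. *)
have rm y z : [set y; z] = [set u; v] -> 2 < deg e y -> 2 <= deg e' y.
  move=> yz; rewrite /deg (cardsD1 z); set A := _ :\ _; move=> h.
  suff : #|A| <= #|[set w | e' y w]| by move: h; case: (z \in _); lia.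
  apply: subset_leq_card; apply/subsetP => w; rewrite !inE => /andP[wz yw].
  rewrite /e' yw /=; apply: contra wz => /eqP E.
  have : w \in [set y; z] by rewrite yz -E !inE eqxx orbT.
  rewrite !inE => /orP[/eqP wy|//]; by rewrite wy eirr in yw.
have [->|xu] := eqVneq x u; first exact: rm (erefl _) du.
have [->|xv] := eqVneq x v; first by apply: rm dv; rewrite setUC.
(* A vertex other than [u] and [v] keeps all its edges. *)
apply: leq_trans d2 _; apply: subset_leq_card; apply/subsetP => y; rewrite !inE => xy.
rewrite /e' xy /=; apply/negP => /eqP E.
by have : x \in [set u; v]; [rewrite -E !inE eqxx | rewrite !inE (negbTE xu) (negbTE xv)].
Qed.
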